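(* Let $S$ be a nonempty finite set, $\Sigma$ an algebra of subsets of $S$, $X$ a nonempty convex subset of a vector space, and $\mathcal{F}$ the set of all functions $f:S\to X$. For $i=1,2$ suppose the collection of preference relations $\{\succsim^i_A\}_{A\in\Sigma}$ on $\mathcal{F}$ admits a conservative subjective expected utility representation $(u_i,\mu_i,\delta_i)$, where $u_1$ is a positive affine transformation of $u_2$ and $\Sigma^1_+=\Sigma^2_+$ (the two collections have the same non-null events). Then the following are equivalent: (i) $\{\succsim^1_A\}_{A\in\Sigma}$ is more conservative than $\{\succsim^2_A\}_{A\in\Sigma}$. (ii) $\delta_1(A)\ge\delta_2(A)$ for every $A$ such that $A$ and $S\setminus A$ are non-null.
   Context: Elements of $\mathcal{F}$ are called acts. An element $x\in X$ is identified with the constant act returning $x$ in every state. For $f,g\in\mathcal{F}$ and $A\in\Sigma$, $fAg$ is the act equal to $f(s)$ for $s\in A$ and to $g(s)$ for $s\in A^c=S\setminus A$. For a collection $\{\succsim_A\}_{A\in\Sigma}$, $\succ_A$ and $\sim_A$ are the asymmetric and symmetric parts of $\succsim_A$, and $\succsim:=\succsim_S$ (so $\succsim^i:=\succsim^i_S$). An event $A\in\Sigma$ is null if $fAg\sim g$ for all $f,g\in\mathcal{F}$, and non-null otherwise; $\Sigma_+$ (resp. $\Sigma^i_+$ for collection $i$) is the collection of non-null events. $\Delta(S)$ is the set of probability measures over $S$, and $\mu(s)=\mu(\{s\})$. For $\mu\in\Delta(S)$ and non-null $A$, the Bayesian update is $\mathcal{B}(\mu,A)(B)=\mu(B\cap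 A)/\mu(A)$. Conservative subjective expected utility representation: a triple $(u,\mu,\delta)$ consisting of a non-constant utility function $u:X\to\mathbb{R}$, a prior probability $\mu\in\Delta(S)$ and a function $\delta:\Sigma_+\to[0,1]$, such that for all $A\in\Sigma_+$ and all $f,g\in\mathcal{F}$, $$f\succsim_A g\iff\sum_{s\in S}u(f(s))\mu_A(s)\ge\sum_{s\in S}u(g(s))\mu_A(s),\qquad \mu_A=\delta(A)\mu+(1-\delta(A))\mathcal{B}(\mu,A).$$ More conservative: $\{\succsim^1_A\}_{A\in\Sigma}$ is more conservative than $\{\succsim^2_A\}_{A\in\Sigma}$ if for all $A\in\Sigma$ and all $x,y_1,y_2\in X$ satisfying (i) $x\succ^i y_i$ for $i=1,2$ and (ii) $xAy_1\succsim^1 z\iff xAy_2\succsim^2 z$ for all $z\in X$, one has, for all $z\in X$, $$xAy_1\succsim^1_A z\implies xAy_2\succsim^2_A z.$$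
   Formalization: The utility functions are assumed affine on X, and in ''more conservative'' the event A ranges only over non-null events (the representation does not restrict preferences at null events); without these two readings the equivalence is false. *)

(* Defs.v *)
(* MathComp / MathComp-Analysis. *)
From HB Require Import structures.
From mathcomp Require Import all_boot all_order all_algebra.
From mathcomp Require Import all_classical all_reals all_analysis.

Set Implicit Arguments.
Unset Strict Implicit.
Unset Printing Implicit Defensive.

Import Order.TTheory GRing.Theory Num.Theory.
Local Open Scope ring_scope.

(* Events are finite sets {set S}; X is a classical set of vectors, coerced to
   the subtype of its elements.  An algebra Sigma need not be the full power
   set, but beliefs are defined on all of {set S}. *)

Definition is_algebra (S : finType) (Sigma : {set {set S}}) : Prop :=
  [/\ [set: S] \in Sigma,
      forall A, A \in Sigma -> ~: A \in Sigma
    & forall A B, A \in Sigma -> B \in Sigma -> A :|: B \in Sigma].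

Section Acts.
Variables (R : realType) (S : finType) (V : lmodType R) (X : set V).

Definition act := {ffun S -> X}.

Definition const_act (x : X) : act := [ffun=> x].

Definition splice (f : act) (A : {set S}) (g : act) : act :=
  [ffun s => if s \in A then f s else g s].

(* A collection {>=_A}: [P A f g] reads "f is weakly preferred to g given A".
   Only its values at events A in Sigma matter. *)
Definition prefs := {set S} -> act -> act -> Prop.

Definition strict (P : prefs) (A : {set S}) (f g : act) : Prop :=
  P A f g /\ ~ P A g f.

Definition indiff (P : prefs) (A : {set S}) (f g : act) : Prop :=
  P A f g /\ P A g f.

Definition null (P : prefs) (A : {set S}) : Prop :=
  forall f g : act, indiff P [set: S] (splice f A g) g.

Definition nonnull (Sigma : {set {set S}}) (P : prefs) (A : {set S}) : Prop :=
  A \in Sigma /\ ~ null P A.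

Definition is_prob (mu : {set S} -> R) : Prop :=
  [/\ forall B, 0 <= mu B,
      mu [set: S] = 1
    & forall B C : {set S}, [disjoint B & C] -> mu (B :|: C) = mu B + mu C].

Definition bayes (mu : {set S} -> R) (A B : {set S}) : R :=
  mu (B :&: A) / mu A.

Definition conditional_belief (mu : {set S} -> R) (delta : {set S} -> R)
    (A B : {set S}) : R :=
  delta A * mu B + (1 - delta A) * bayes mu A B.

Definition expected_utility (u : X -> R) (nu : {set S} -> R) (f : act) : R :=
  \sum_(s : S) u (f s) * nu [set s].

(* The mixture t x + (1 - t) y is passed as an element z of X, so that no
   proof that X is convex is needed to state affinity. *)
Definition affine (u : X -> R) : Prop :=
  forall (x y z : X) (t : R), 0 <= t <= 1 ->
    val z = t *: val x + (1 - t) *: val y ->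
    u z = t * u x + (1 - t) * u y.

Definition nonconstant (u : X -> R) : Prop := exists x y : X, u x <> u y.

(* Utility over the convex set X is taken to be affine, as is standard for
   expected utility over a mixture space; [delta] is a function on non-null
   events, so its values elsewhere are unconstrained and unused. *)
Definition csEU (Sigma : {set {set S}}) (P : prefs)
    (u : X -> R) (mu : {set S} -> R) (delta : {set S} -> R) : Prop :=
  [/\ nonconstant u /\ affine u,
      is_prob mu,
      forall A, nonnull Sigma P A -> 0 <= delta A <= 1
    & forall A, nonnull Sigma P A -> forall f g : act,
        P A f g <->
        expected_utility u (conditional_belief mu delta A) g
          <= expected_utility u (conditional_belief mu delta A) f].

Definition pos_affine_transform (u v : X -> R) : Prop :=
  exists a b : R, 0 < a /\ forall x, u x = a * v x + b.

(* The event ranges over events that are non-null for both collections: a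
   representation places no restriction on the conditional preference at a
   null event, so comparisons there are not meaningful. *)
Definition more_conservative (Sigma : {set {set S}}) (P1 P2 : prefs) : Prop :=
  forall A, nonnull Sigma P1 A -> nonnull Sigma P2 A ->
  forall x y1 y2 : X,
    strict P1 [set: S] (const_act x) (const_act y1) ->
    strict P2 [set: S] (const_act x) (const_act y2) ->
    (forall z : X,
       P1 [set: S] (splice (const_act x) A (const_act y1)) (const_act z) <->
       P2 [set: S] (splice (const_act x) A (const_act y2)) (const_act z)) ->
    forall z : X,
      P1 A (splice (const_act x) A (const_act y1)) (const_act z) ->
      P2 A (splice (const_act x) A (const_act y2)) (const_act z).

End Acts.

(* Main.v *)
Require Import Defs.
From HB Require Import structures.
From mathcomp Require Import all_boot all_order all_algebra.
From mathcomp Require Import all_classical all_reals all_analysis.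
From mathcomp Require Import ring lra.

(** Normalise both representations to a common utility [u].  If [u y < u x],
    the bet on [A] paying [x] on [A] and [y] elsewhere is worth [u x - L]
    ex ante and [u x - delta A * L] given [A], where
    [L = (1 - mu A) * (u x - u y)].  The bets compared in the definition of
    "more conservative" have the same ex ante value, hence the same [L], so the
    definition compares [delta1 A * L] with [delta2 A * L].  Here [L = 0] exactly
    when the complement of [A] is null; otherwise equally valued bets with
    [L > 0] exist because [X] is convex. *)

Set Implicit Arguments.
Unset Strict Implicit.
Unset Printing Implicit Defensive.

Import Order.TTheory GRing.Theory Num.Theory.
Local Open Scope ring_scope.

(** * Probabilities on a finite set and their conditional mixtures *)

Section Probability.
Variables (R : realType) (S : finType).
Implicit Types (mu delta : {set S} -> R) (A B : {set S}).

Lemma prob_set0 mu : is_prob mu -> mu finset.set0 = 0.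
Proof.
case=> _ _ /(_ finset.set0 finset.set0); rewrite finset.setU0.
have -> : [disjoint (finset.set0 : {set S}) & finset.set0].
  by rewrite -setI_eq0 finset.setI0.
by move=> /(_ isT); lra.
Qed.

Lemma prob_sum mu A : is_prob mu -> mu A = \sum_(s in A) mu [set s]%SET.
Proof.
move=> hmu; have [_ _ muU] := hmu.
have [n] := ubnP #|A|; elim: n A => // n IH A.
have [-> _|[x xA]] := finset.set_0Vmem A; first by rewrite big_set0 prob_set0.
rewrite (cardsD1 x) xA ltnS add1n => /IH muAx.
rewrite (finset.big_setD1 x) //= -muAx -muU ?finset.setD1K //.
by rewrite disjoints1 finset.in_setD1 eqxx.
Qed.

Lemma prob_setC mu A : is_prob mu -> mu (~: A) = 1 - mu A.
Proof.
case=> _ mu1 muU.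
have := muU A (~: A); rewrite -setI_eq0 finset.setICr eqxx finset.setUCr mu1.
by move=> /(_ isT) ->; lra.
Qed.

Lemma prob_le1 mu A : is_prob mu -> mu A <= 1.
Proof.
move=> hmu; have [mu0 _ _] := hmu.
by have := mu0 (~: A); rewrite prob_setC // subr_ge0.
Qed.

Lemma conditional_belief_prob mu delta A :
  is_prob mu -> 0 < mu A -> 0 <= delta A <= 1 ->
  is_prob (conditional_belief mu delta A).
Proof.
move=> [mu0 mu1 muU] A0 /andP[d0 d1]; split=> [B||B C BC].
- by rewrite addr_ge0 // mulr_ge0 ?subr_ge0 // /bayes divr_ge0.
- by rewrite /conditional_belief /bayes mu1 finset.setTI divff ?gt_eqF //; lra.
- rewrite /conditional_belief /bayes finset.setIUl !muU //; first by ring.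
  exact: disjointW (finset.subsetIl B A) (finset.subsetIl C A) BC.
Qed.

(** Updating on the sure event returns the prior, so both terms of the mixture are [mu B]. Hence the
    representation at [[set: S]] describes the ex ante preference by [mu] alone. *)
Lemma conditional_beliefT mu delta B :
  is_prob mu -> conditional_belief mu delta [set: S] B = mu B.
Proof.
case=> _ mu1 _; rewrite /conditional_belief /bayes finset.setIT mu1 divr1.
by ring.
Qed.

(** The Bayesian part puts all its mass on [A], so only the prior, with weight [delta A], leaves
    mass outside. *)
Lemma conditional_belief_self mu delta A :
  0 < mu A -> 1 - conditional_belief mu delta A A = delta A * (1 - mu A).
Proof.
move=> A0; rewrite /conditional_belief /bayes finset.setIid divff ?gt_eqF //.
by ring.
Qed.

End Probability.

(** * Acts, bets and their expected utility *)

Section Representation.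
Variables (R : realType) (S : finType) (V : lmodType R) (X : set V).
Implicit Types (Sigma : {set {set S}}) (P : prefs S X) (u v : X -> R).
Implicit Types (mu nu delta : {set S} -> R) (A B : {set S}) (x y z : X).

Lemma splice_id (f : act S X) A : splice f A f = f.
Proof. by apply/ffunP=> s; rewrite ffunE if_same. Qed.

Lemma spliceT (f g : act S X) : splice f [set: S] g = f.
Proof. by apply/ffunP=> s; rewrite ffunE finset.in_setT. Qed.

(** Provides outcomes with any prescribed utility between two attained ones; convexity keeps the
    mixture inside [X]. *)
Lemma affine_mixture u x y (t : R) :
  convex_set (X : set (convex_lmodType V)) -> affine u -> 0 <= t <= 1 ->
  exists z, u z = t * u x + (1 - t) * u y.
Proof.
move=> hX hu /[dup] t01 /andP[t0 t1].
have zX := hX (val x) (val y) (Itv01 t0 t1) (valP x) (valP y).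
by exists (exist (fun z : V => z \in X) _ zX); apply: hu.
Qed.

Lemma expected_utility_splice u nu x y B : is_prob nu ->
  expected_utility u nu (splice (const_act S x) B (const_act S y)) =
  u x - (1 - nu B) * (u x - u y).
Proof.
move=> hnu; rewrite /expected_utility (bigID (mem B)) /=.
under eq_bigr => s sB do rewrite ffunE sB ffunE.
under [X in _ + X]eq_bigr => s /negPf sB do rewrite ffunE sB ffunE.
rewrite -!mulr_sumr -prob_sum //.
rewrite (eq_bigl (mem (~: B))) => [|s]; last by rewrite /= finset.in_setC.
by rewrite -prob_sum // prob_setC //; ring.
Qed.

Lemma expected_utility_const u nu x : is_prob nu ->
  expected_utility u nu (const_act S x) = u x.
Proof.
(* A constant act is a bet on the empty event with equal prizes. *)
move=> hnu; rewrite -[const_act S x](splice_id _ finset.set0).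
by rewrite expected_utility_splice // subrr mulr0 subr0.
Qed.

Lemma expected_utility_affine u v nu (a b : R) f : is_prob nu ->
  (forall x, u x = a * v x + b) ->
  expected_utility u nu f = a * expected_utility v nu f + b.
Proof.
move=> hnu uv; have [_ nu1 _] := hnu; rewrite /expected_utility.
under eq_bigr => s _ do rewrite uv mulrDl -mulrA.
rewrite big_split /= -!mulr_sumr; congr (_ + _).
by under eq_bigl => s do rewrite -(finset.in_setT s); rewrite -prob_sum // nu1 mulr1.
Qed.

Lemma nonnull_setT Sigma P A :
  is_algebra Sigma -> nonnull Sigma P A -> nonnull Sigma P [set: S].
Proof.
move=> [T _ _] [_ nA]; split=> // n; apply: nA => f g.
by have := n (splice f A g) g; rewrite spliceT.
Qed.

(** * Null events and bets under a representation *)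

Section CsEU.
Variables (Sigma : {set {set S}}) (P : prefs S X) (u : X -> R).
Variables (mu delta : {set S} -> R).
Hypotheses (algS : is_algebra Sigma) (rep : csEU Sigma P u mu delta).

Lemma csEU_priorP f g : nonnull Sigma P [set: S] ->
  P [set: S] f g <-> expected_utility u mu g <= expected_utility u mu f.
Proof.
case: rep => _ hmu _ hP hT.
have E h : expected_utility u (conditional_belief mu delta [set: S]) h =
           expected_utility u mu h.
  by apply: eq_bigr => s _; rewrite conditional_beliefT.
by rewrite -!E; exact: hP.
Qed.

(** If [mu A] were zero, so would be the mass of each state of [A]; changing an act on [A] would
    then leave its expected utility unchanged, making [A] null. *)
Lemma csEU_nonnull_gt0 A : nonnull Sigma P A -> 0 < mu A.
Proof.
move=> hA; have hT := nonnull_setT algS hA.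
have [_ hmu _ _] := rep; have [mu0 _ _] := hmu.
rewrite lt_def mu0 andbT; apply/negP => /eqP muA.
have mus s : s \in A -> mu [set s]%SET = 0.
  move=> sA; move: muA; rewrite (prob_sum _ hmu) => /psumr_eq0P; exact.
case: hA => _; apply=> f g.
have E : expected_utility u mu (splice f A g) = expected_utility u mu g.
  apply: eq_bigr => s _; rewrite ffunE.
  by case: ifPn => // sA; rewrite mus // !mulr0.
by split; apply/csEU_priorP; rewrite // E.
Qed.

(** Nullness is tested on two constants of different utility: indifference forces
    [(u x - u y) * mu A = 0]. *)
Lemma csEU_null_eq0 A :
  nonnull Sigma P [set: S] -> null P A -> mu A = 0.
Proof.
move=> hT nA; have [[[x [y xy]] _] hmu _ _] := rep.
have [/(csEU_priorP _ _ hT) + /(csEU_priorP _ _ hT)] :=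
  nA (const_act S x) (const_act S y).
rewrite expected_utility_splice // expected_utility_const // => le1 le2.
apply/eqP; have : (u x - u y) * mu A == 0 by apply/eqP; lra.
by rewrite mulf_eq0 subr_eq0 => /orP[/eqP /xy|].
Qed.

Lemma csEU_prior_betP A x y z : nonnull Sigma P [set: S] ->
  P [set: S] (splice (const_act S x) A (const_act S y)) (const_act S z) <->
  u z <= u x - (1 - mu A) * (u x - u y).
Proof.
have [_ hmu _ _] := rep; move=> hT.
by rewrite csEU_priorP // expected_utility_splice // expected_utility_const.
Qed.

Lemma csEU_strict_constP x y : nonnull Sigma P [set: S] ->
  strict P [set: S] (const_act S x) (const_act S y) <-> u y < u x.
Proof.
have [_ hmu _ _] := rep; move=> hT.
rewrite /strict !csEU_priorP // !expected_utility_const // ltNge.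
split=> [[_ /negP]//|yx]; split; last exact/negP.
by rewrite ltW // ltNge.
Qed.

Lemma csEU_betP A x y z : nonnull Sigma P A ->
  P A (splice (const_act S x) A (const_act S y)) (const_act S z) <->
  u z <= u x - delta A * ((1 - mu A) * (u x - u y)).
Proof.
have [_ hmu hd hP] := rep; move=> hA.
have A0 := csEU_nonnull_gt0 hA.
have hcb := conditional_belief_prob hmu A0 (hd _ hA).
rewrite hP // expected_utility_splice // expected_utility_const //.
by rewrite conditional_belief_self // mulrA.
Qed.

Lemma csEU_pos_affine v : pos_affine_transform u v -> csEU Sigma P v mu delta.
Proof.
have [[[x [y xy]] aff] hmu hd hP] := rep.
move=> [a [b [a0 uv]]]; split=> //; last first.
  move=> A hA f g; rewrite hP //.
  have hcb := conditional_belief_prob hmu (csEU_nonnull_gt0 hA) (hd _ hA).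
  by rewrite !(expected_utility_affine _ hcb uv) lerD2r ler_pM2l.
split; first by exists x, y => vxy; apply: xy; rewrite !uv vxy.
move=> p q z t t01 /(aff _ _ _ _ t01); rewrite !uv => E.
by apply: (mulfI (lt0r_neq0 a0)); lra.
Qed.

End CsEU.

End Representation.

Theorem proposition3 (R : realType) (S : finType) (hS : (0 < #|S|)%N)
    (Sigma : {set {set S}}) (hSigma : is_algebra Sigma)
    (V : lmodType R) (X : set V)
    (hX0 : (X !=set0)%classic) (hX : convex_set (X : set (convex_lmodType V)))
    (P1 P2 : prefs S X)
    (u1 u2 : X -> R) (mu1 mu2 : {set S} -> R) (delta1 delta2 : {set S} -> R)
    (hrep1 : csEU Sigma P1 u1 mu1 delta1)
    (hrep2 : csEU Sigma P2 u2 mu2 delta2)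
    (hu : pos_affine_transform u1 u2)
    (hnull : forall A, nonnull Sigma P1 A <-> nonnull Sigma P2 A) :
  more_conservative Sigma P1 P2 <->
  (forall A, nonnull Sigma P1 A -> nonnull Sigma P1 (~: A) ->
     delta2 A <= delta1 A).
Proof.
move: u2 hu hrep1 hrep2 => u hu /(csEU_pos_affine hSigma)/(_ _ hu) rep1 rep2.
have [[[x0 [y0 xy0]] aff] pr1 hd1 _] := rep1; have [_ pr2 hd2 _] := rep2.
split=> [cons A hA hcA|le_delta A hA1 hA2 x y1 y2].
  have hA' := (hnull A).1 hA; have hcA' := (hnull (~: A)).1 hcA.
  have hT1 := nonnull_setT hSigma hA; have hT2 := nonnull_setT hSigma hA'.
  have [x [y yx]] : exists x y, u y < u x.
    by case: (ltgtP (u x0) (u y0)) => // h; [exists y0, x0|exists x0, y0].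
  have := csEU_nonnull_gt0 hSigma rep1 hcA; rewrite (prob_setC _ pr1).
  have := csEU_nonnull_gt0 hSigma rep2 hcA'; rewrite (prob_setC _ pr2).
  set l1 := 1 - mu1 A; set l2 := 1 - mu2 A => l2_gt0 l1_gt0.
  have l1_le1 : l1 <= 1 by case: pr1 => /(_ A) + _ _; rewrite /l1; lra.
  have l2_le1 : l2 <= 1 by case: pr2 => /(_ A) + _ _; rewrite /l2; lra.
  (* each [y_i] is moved towards [x] in proportion to the other prior's weight
     on the complement, which equalises the ex ante losses *)
  have [|y1 uy1] := @affine_mixture _ _ _ u y x l2 hX aff; first lra.
  have [|y2 uy2] := @affine_mixture _ _ _ u y x l1 hX aff; first lra.
  have l12_gt0 : 0 < l1 * l2 by rewrite mulr_gt0.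
  have D1 : u x - u y1 = l2 * (u x - u y) by rewrite uy1; ring.
  have D2 : u x - u y2 = l1 * (u x - u y) by rewrite uy2; ring.
  have [/andP[d1_ge0 d1_le1]] := hd1 A hA.
  (* The weight makes [z] worth exactly the first bet given [A], so the premise on [P1 A] will hold
     with equality. *)
  have [|z uz] := @affine_mixture _ _ _ u y x (delta1 A * (l1 * l2)) hX aff.
    have l12_le1 : l1 * l2 <= 1 by rewrite mulr_ile1 // ltW.
    by rewrite mulr_ge0 ?mulr_ile1 // ltW.
  have yx_gt0 : 0 < u x - u y by rewrite subr_gt0.
  have := cons A hA hA' x y1 y2.
  rewrite (csEU_strict_constP rep1) // (csEU_strict_constP rep2) //.
  rewrite -subr_gt0 D1 -[u y2 < _]subr_gt0 D2 !mulr_gt0 // => /(_ isT isT) H.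
  have {H} := H _ z.
  rewrite (csEU_betP hSigma rep1) // (csEU_betP hSigma rep2) // D1 D2.
  (* Scaling by the common ex ante loss [l1 * l2 * (u x - u y)] turns the comparison of weights into
     one of conditional losses. *)
  rewrite uz -/l1 -/l2 => H; rewrite -(ler_pM2r l12_gt0) -(ler_pM2r yx_gt0).
  suff: delta1 A * (l1 * l2) * u y + (1 - delta1 A * (l1 * l2)) * u x <=
        u x - delta2 A * (l2 * (l1 * (u x - u y))) by lra.
  apply: H => [w|]; last lra.
  by rewrite (csEU_prior_betP rep1) // (csEU_prior_betP rep2) // D1 D2 mulrCA.
have hT1 := nonnull_setT hSigma hA1; have hT2 := nonnull_setT hSigma hA2.
rewrite (csEU_strict_constP rep1) // (csEU_strict_constP rep2) // => y1x y2x H z.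
have {H} losses : (1 - mu1 A) * (u x - u y1) = (1 - mu2 A) * (u x - u y2).
  have mu01 (mu : {set S} -> R) : is_prob mu -> 0 <= mu A <= 1.
    by move=> hmu; rewrite prob_le1 // andbT; case: hmu.
  (* [w1] and [w2] are ex ante certainty equivalents of the two bets. Each bet is weakly preferred
     to its own equivalent, hence by [H] so is the other bet, which gives both inequalities. *)
  have [w1 uw1] := affine_mixture x y1 hX aff (mu01 _ pr1).
  have [w2 uw2] := affine_mixture x y2 hX aff (mu01 _ pr2).
  have := (H w1).1; rewrite (csEU_prior_betP rep1) // (csEU_prior_betP rep2) //.
  have := (H w2).2; rewrite (csEU_prior_betP rep1) // (csEU_prior_betP rep2) //.
  rewrite uw1 uw2 => le12 le21; apply/eqP; rewrite eq_le; apply/andP; split.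
    suff: u w2 <= u x - (1 - mu1 A) * (u x - u y1) by rewrite uw2; lra.
    by rewrite uw2; apply: le12; lra.
  suff: u w1 <= u x - (1 - mu2 A) * (u x - u y2) by rewrite uw1; lra.
  by rewrite uw1; apply: le21; lra.
rewrite (csEU_betP hSigma rep1) // (csEU_betP hSigma rep2) // -losses.
have [cn|cn] := pselect (nonnull Sigma P1 (~: A)).
  move=> /le_trans; apply; rewrite lerD2l lerN2 ler_wpM2r ?le_delta //.
  by rewrite mulr_ge0 ?subr_ge0 ?prob_le1 // ltW.
(* With a null complement the common loss is zero, so both bets are worth [u x] given [A], whatever
   the two weights are. *)
have : mu1 (~: A) = 0.
  apply: (csEU_null_eq0 rep1) => //; apply: contrapT => nn; apply: cn; split=> //.
  by case: hSigma hA1 => _ + _ [+ _]; apply.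
by rewrite prob_setC // => ->; rewrite !mul0r !mulr0.
Qed.
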